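(* Let $C=e^{-6}$ and $\psi(x)=Cx$. Let $d\ge 1$ and let $f_{\psi,d}:\{1,\dots,d\}\to\mathbb{R}_{>0}$ be defined by $f_{\psi,d}(d)=1$ and, for $i<d$, $f_{\psi,d}(i)=\sqrt{\psi(d-i+1)}\left(\prod_{k=i}^d f_{\psi,d}(k)\right)^{\frac{1}{d-i+1}}$. Then for all $1\le i<j\le d$, \[ (j-i+1)^{-\frac{j-i}{2}}\left(1-\left(\frac{f_{\psi,d}(j)}{f_{\psi,d}(i)}\right)^2\right)_+^{\frac{j-i}{2}}\left(\prod_{k=i}^{j}\frac{f_{\psi,d}(i)}{f_{\psi,d}(k)}\right)\le\left(2\pi e(\sqrt{e}+1)^2\right)^{-\frac{j-i}{2}}. \]
   Context: For real $x$, $(x)_+=\max(x,0)$; $e$ is Euler's number. The defining relation for $f_{\psi,d}(i)$ involves $f_{\psi,d}(i)$ on both sides; it determines it uniquely, namely $f_{\psi,d}(i)^{d-i}=\psi(d-i+1)^{\frac{d-i+1}{2}}\prod_{k=i+1}^d f_{\psi,d}(k)$, computed recursively from $i=d-1$ down to $i=1$. *)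

(* Defs.v *)
From mathcomp Require Import all_boot all_order all_algebra.
From mathcomp Require Import all_classical all_reals all_analysis.

Set Implicit Arguments.
Unset Strict Implicit.
Unset Printing Implicit Defensive.

Import Order.TTheory GRing.Theory Num.Theory.
Local Open Scope ring_scope.

Definition psi (R : realType) (x : R) : R := expR (- 6) * x.

(* [f] is constrained only on {1, ..., d}. The product on the right-hand side
   of the last clause starts at [k = i], so the relation is implicit in [f i];
   together with positivity it determines [f i] from f (i+1), ..., f d. *)
Definition is_f_psi (R : realType) (p : R -> R) (d : nat) (f : nat -> R) :
    Prop :=
  [/\ forall i : nat, (1 <= i <= d)%N -> 0 < f i,
      f d = 1 &
      forall i : nat, (1 <= i < d)%N ->
        f i = Num.sqrt (p (d - i + 1)%:R) *
              (\prod_(i <= k < d.+1) f k) `^ (1 / (d - i + 1)%:R)].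

(* Main.v *)
(* Put n = d - j + 1, l = j - i and t = (f j / f i)^2.  Taking logarithms, the
   defining relation at i and j evaluates the two tail sums of ln f, and hence
   the product of the f i / f k, in terms of n, l and ln t only (with an
   inequality when j = d, where the relation fails).  The claim becomes
   (n+l) ln (n+l) - n ln n + l ln (1-t) + (n-1) ln t - 6 l
     <= l ln (l+1) - l ln B
   with B the constant of the theorem.  It holds for every t in (0,1): Gibbs'
   inequality eliminates t, ln x <= x - 1 bounds the rest by l ln (l+1) - 5 l,
   and ln B <= 5. *)

Require Import Defs.
From mathcomp Require Import all_boot all_order all_algebra.
From mathcomp Require Import all_classical all_reals all_analysis.
From mathcomp Require Import ring lra.

Import Order.TTheory GRing.Theory Num.Theory.
Import numFieldTopology.Exports numFieldNormedType.Exports.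
Local Open Scope ring_scope.

Lemma pi_le_86_25 (R : realType) : (pi : R) <= 86 / 25.
Proof.
(* Mean value theorem; the derivative 1 / (1 + x^2) decreases for x >= 0. *)
have atan_incr (a b c : R) : 0 <= a -> a < b -> (1 + a ^+ 2)^-1 <= c ->
    atan b - atan a <= c * (b - a).
  move=> a0 ab hc.
  have ctan : {within `[a, b], continuous (@atan R)}%classic.
    by apply: continuous_subspaceT => x; exact: continuous_atan.
  have [x xab ->] := MVT ab (fun x _ => is_derive1_atan x) ctan.
  rewrite ler_wpM2r ?subr_ge0 ?(ltW ab)//; apply: le_trans hc.
  move: xab; rewrite in_itv/= => /andP[ax _].
  rewrite lef_pV2 ?posrE ?ltr_wpDr ?sqr_ge0//.
  by rewrite lerD2l ler_sqr ?nnegrE// ?(ltW ax)// (le_trans a0 (ltW ax)).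
(* pi / 4 = atan 1, bounded by the upper Riemann sum of 1 / (1 + x^2) on the
   subdivision 0, 1/2, 3/4, 1. *)
have h1 : atan (1 / 2 : R) - atan 0 <= 1 * (1 / 2 - 0).
  by apply: atan_incr; [by []|lra|rewrite expr0n/= addr0 invr1].
have h2 : atan (3 / 4 : R) - atan (1 / 2) <= 4 / 5 * (3 / 4 - 1 / 2).
  apply: atan_incr; [lra|lra|].
  by rewrite (_ : 1 + _ = 5 / 4) ?invf_div//; lra.
have h3 : atan (1 : R) - atan (3 / 4) <= 16 / 25 * (1 - 3 / 4).
  apply: atan_incr; [lra|lra|].
  by rewrite (_ : 1 + _ = 25 / 16) ?invf_div//; lra.
by move: h1 h2 h3; rewrite atan1 atan0; lra.
Qed.

(** Start from 17/16 <= exp (1/16) and square three times, rounding down to a small fraction each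
    time. *)
Lemma expR_half_ge (R : realType) : 81 / 50 <= expR (1 / 2) :> R.
Proof.
have step (a b x : R) : 0 <= a -> b <= a ^+ 2 -> a <= expR x ->
    b <= expR (2 * x).
  move=> a0 ba ax; rewrite expRM_natl; apply: (le_trans ba).
  by rewrite ler_sqr ?nnegrE ?expR_ge0.
have -> : 1 / 2 = 2 * (2 * (2 * (1 / 16))) :> R by lra.
apply: (step (135 / 106)); [lra|lra|].
apply: (step (79 / 70)); [lra|lra|].
apply: (step (17 / 16)); [lra|lra|].
by apply: le_trans (expR_ge1Dx _); lra.
Qed.

(** With s = sqrt e this reads 2 pi (s + 1)^2 <= s^8. *)
Lemma ln_constant_le5 (R : realType) :
  ln (2 * pi * expR 1 * (Num.sqrt (expR 1) + 1) ^+ 2) <= 5 :> R.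
Proof.
pose s : R := expR (1 / 2).
have s_ge : 81 / 50 <= s := expR_half_ge R.
have e1 : expR 1 = s ^+ 2 :> R by rewrite /s -expRM_natl; congr expR; lra.
have e5 : expR 5 = s ^+ 10 :> R by rewrite /s -expRM_natl; congr expR; lra.
have pi0 : 0 < pi :> R := pi_gt0 R.
have pi_le := pi_le_86_25 R.
rewrite e1 sqrtr_sqr ger0_norm ?expR_ge0//.
have s0 : 0 < s by exact: expR_gt0.
have p0 : 0 < 2 * pi * s ^+ 2 * (s + 1) ^+ 2.
  by apply: mulr_gt0; [apply: mulr_gt0; [lra|]|]; rewrite exprn_gt0// addr_gt0.
rewrite -[leRHS]expRK ler_ln ?posrE ?expR_gt0// e5.
have h2 : 328 / 125 <= s ^+ 2 by nra.
have h3 : 17 / 4 <= s ^+ 3 by rewrite exprS; nra.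
(* The square of 21/8 just exceeds 172/25, the upper bound for 2 pi. *)
have h4 : 21 / 8 * (s + 1) <= s ^+ 4 by rewrite exprS; nra.
have h8 : 172 / 25 * (s + 1) ^+ 2 <= (s ^+ 4) ^+ 2.
  apply: (@le_trans _ _ ((21 / 8 * (s + 1)) ^+ 2)); first by nra.
  by rewrite ler_sqr ?nnegrE ?exprn_ge0 ?(ltW s0)//; lra.
have -> : 2 * pi * s ^+ 2 * (s + 1) ^+ 2 = s ^+ 2 * (2 * pi * (s + 1) ^+ 2).
  by ring.
rewrite -[10%N]/(2 + 4 * 2)%N exprD exprM ler_pM2l ?exprn_gt0//.
apply: le_trans h8; rewrite ler_wpM2r ?sqr_ge0//; lra.
Qed.

Lemma ln_leB1 (R : realType) (x : R) : 0 < x -> ln x <= x - 1.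
Proof.
by move=> x0; have := @le_ln1Dx R (x - 1); rewrite [1 + _]addrC subrK; apply; lra.
Qed.

(* Gibbs' inequality for the weights [l / (l + p)] and [p / (l + p)], with the
   term [ln (p / (l + p)) <= 0] dropped so that [p = 0] is allowed. *)
Lemma gibbs2 (R : realType) (l p t : R) : 0 < l -> 0 <= p -> 0 < t < 1 ->
  l * ln (1 - t) + p * ln t <= l * (ln l - ln (l + p)).
Proof.
move=> l0 p0 /andP[t0 t1].
have lp0 : 0 < l + p by lra.
(* The right-hand sides of [h1] and [h2] add up to 0. *)
have h1 : l * (ln (1 - t) - (ln l - ln (l + p))) <= (1 - t) * (l + p) - l.
  have t1' : 0 < 1 - t by lra.
  rewrite -ln_div ?posrE// -ln_div ?posrE ?divr_gt0//.
  have -> : (1 - t) * (l + p) - l = l * ((1 - t) / (l / (l + p)) - 1).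
    by field; rewrite !gt_eqF.
  by rewrite ler_pM2l//; apply: ln_leB1; rewrite !divr_gt0.
have h2 : p * ln t <= t * (l + p) - p.
  move: p0; rewrite le_eqVlt => /predU1P[<-|p0].
    by rewrite mul0r subr0 addr0 mulr_ge0// ltW.
  have -> : t * (l + p) - p = p * (t / (p / (l + p)) - 1).
    by field; rewrite !gt_eqF.
  rewrite ler_pM2l//; apply: le_trans (ln_leB1 _ _ _); last by rewrite !divr_gt0.
  rewrite ler_ln ?posrE ?divr_gt0// ler_pdivlMr ?divr_gt0//.
  rewrite ler_piMr// ?ler_pdivrMr//; lra.
lra.
Qed.

Lemma mulln_sub_le (R : realType) (n l : R) : 0 < n -> 0 < l ->
  n * (ln (n + l) - ln n) <= l.
Proof.
move=> n0 l0; rewrite -ln_div ?posrE ?addr_gt0//.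
have := @ln_leB1 R ((n + l) / n) (divr_gt0 (addr_gt0 n0 l0) n0).
rewrite -(ler_pM2l n0) => /le_trans; apply.
by rewrite le_eqVlt; apply/orP; left; apply/eqP; field; rewrite gt_eqF.
Qed.

Lemma entropy_bound (R : realType) (n l t : R) : 1 <= n -> 1 <= l -> 0 < t < 1 ->
  (n + l) * ln (n + l) - n * ln n + l * ln (1 - t) + (n - 1) * ln t
    <= l * (ln (l + 1) + 1).
Proof.
move=> n1 l1 ht.
have g := @gibbs2 R l (n - 1) t ltac:(lra) ltac:(lra) ht.
have h := @mulln_sub_le R n l ltac:(lra) ltac:(lra).
(* What remains is (n + l) l <= (l + 1) (l + n - 1), whose sides differ by n - 1. *)
suff : l * (ln (n + l) + ln l) <= l * (ln (l + 1) + ln (l + (n - 1))) by lra.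
rewrite ler_pM2l; last by lra.
rewrite -!lnM ?posrE; try lra.
rewrite ler_ln ?posrE ?mulr_gt0//; lra.
Qed.

Lemma ln_prod_nat (R : realType) (F : nat -> R) (m n : nat) :
  (forall k, (m <= k < n)%N -> 0 < F k) ->
  0 < \prod_(m <= k < n) F k /\
  ln (\prod_(m <= k < n) F k) = \sum_(m <= k < n) ln (F k).
Proof.
move=> F0; rewrite 2!big_nat; apply: (big_ind2 (fun x y => 0 < x /\ ln x = y)).
- by rewrite ln1.
- by move=> x a y b [x0 <-] [y0 <-]; rewrite mulr_gt0// lnM.
- by move=> k /F0.
Qed.

Section recursion.
Variables (R : realType) (d : nat) (f : nat -> R).
Hypothesis hf : is_f_psi (@psi R) d f.

Local Notation T i := (\sum_(i <= k < d.+1) ln (f k)).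

Lemma f_psi_gt0 i : (1 <= i <= d)%N -> 0 < f i.
Proof. by case: hf => h _ _; exact: h. Qed.

(** The logarithm of the defining relation, solved for the tail sum; -6 is the logarithm of the
    constant in [psi]. *)
Lemma tail_sum_ln i : (1 <= i < d)%N ->
  T i = (d - i + 1)%:R * (ln (f i) - (ln (d - i + 1)%:R - 6) / 2).
Proof.
move=> /andP[i1 id]; have [k /andP[ik kd]|P0 lnP] := ln_prod_nat R f i d.+1.
  by rewrite f_psi_gt0// (leq_trans i1 ik).
case: hf => _ _ /(_ i); rewrite i1 id => /(_ isT) fi.
have m0 : 0 < (d - i + 1)%:R :> R by rewrite ltr0n addn1.
have p0 : 0 < psi (d - i + 1)%:R :> R by rewrite /psi mulr_gt0// expR_gt0.
rewrite fi lnM ?posrE ?powR_gt0 ?sqrtr_gt0// ln_powR lnP.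
rewrite -powR12_sqrt ?(ltW p0)// ln_powR /psi lnM ?posrE ?expR_gt0// expRK.
by field; rewrite gt_eqF.
Qed.

Lemma tail_sum_ln_succ_le j : (1 <= j <= d)%N ->
  T j.+1 <= (d - j)%:R * ln (f j)
            - (d - j + 1)%:R * (ln (d - j + 1)%:R - 6) / 2.
Proof.
move=> /andP[j1]; rewrite leq_eqVlt => /predU1P[->|jd].
  (* For j = d the sum is empty and the bound reads 0 <= 3. *)
  by rewrite big_geq// subnn mul0r add0n ln1; lra.
have := tail_sum_ln j; rewrite j1 jd => /(_ isT).
rewrite big_ltn ?ltnS ?(ltnW jd)// natrD; lra.
Qed.

(** The sum is (l + 1) ln (f i) - T i + T (j + 1). There ln (f i) and ln (f j) get the opposite
    coefficients -(d - j) and d - j, so only the ratio f j / f i survives. *)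
Lemma sum_ln_ratio_le i j : (1 <= i)%N -> (i < j)%N -> (j <= d)%N ->
  2 * \sum_(i <= k < j.+1) (ln (f i) - ln (f k)) <=
    (d - i + 1)%:R * ln (d - i + 1)%:R - (d - j + 1)%:R * ln (d - j + 1)%:R
    - 6 * (j - i)%:R + (d - j)%:R * (2 * (ln (f j) - ln (f i))).
Proof.
move=> i1 ij jd.
have Ti := tail_sum_ln i; rewrite i1 (leq_trans ij jd) in Ti.
have Tj := tail_sum_ln_succ_le j; rewrite jd (leq_trans i1 (ltnW ij)) in Tj.
have {}Ti := Ti isT; have {}Tj := Tj isT.
have TE : T i = \sum_(i <= k < j.+1) ln (f k) + T j.+1.
  by apply: big_cat_nat; rewrite ?ltnS// leqW// ltnW.
have dj : (d - i + 1)%:R = (d - j + 1)%:R + (j - i)%:R :> R.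
  by rewrite -natrD; congr _%:R; rewrite addnAC addnBA ?(ltnW ij)// subnK.
have dj1 : (d - j + 1)%:R = (d - j)%:R + 1 :> R by rewrite natrD.
rewrite sumrB sumr_const_nat subSn ?(ltnW ij)// -mulr_natl -addn1 natrD.
rewrite dj in Ti *; nra.
Qed.

End recursion.

Theorem theorem2 (R : realType) (d : nat) (f : nat -> R)
    (hd : (1 <= d)%N) (hf : is_f_psi (@psi R) d f) :
  forall i j : nat, (1 <= i)%N -> (i < j)%N -> (j <= d)%N ->
    (j - i + 1)%:R `^ (- ((j - i)%:R / 2))
    * Num.max (1 - (f j / f i) ^+ 2) 0 `^ ((j - i)%:R / 2)
    * \prod_(i <= k < j.+1) (f i / f k)
    <= (2 * pi * expR 1 * (Num.sqrt (expR 1) + 1) ^+ 2)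
         `^ (- ((j - i)%:R / 2)).
Proof.
move=> i j i1 ij jd.
have f_gt0 k : (1 <= k <= d)%N -> 0 < f k by exact: f_psi_gt0 hf k.
have fi0 : 0 < f i by rewrite f_gt0// i1 (leq_trans (ltnW ij) jd).
have fj0 : 0 < f j by rewrite f_gt0// jd (leq_trans i1 (ltnW ij)).
have l1 : 1 <= (j - i)%:R :> R by rewrite ler1n subn_gt0.
set t := (f j / f i) ^+ 2.
have t0 : 0 < t by rewrite exprn_gt0// divr_gt0.
(* For t >= 1 the positive part vanishes, and so does its power, the exponent being nonzero. *)
have [t1|t1] := leP 1 t.
  rewrite max_r ?subr_le0// powR0 ?mulr0 ?mul0r ?powR_ge0//.
  by rewrite gt_eqF//; lra.
rewrite max_l ?subr_ge0 ?(ltW t1)//.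
set B := 2 * pi * _ * _.
have B0 : 0 < B.
  by rewrite /B !mulr_gt0 ?pi_gt0 ?expR_gt0// exprn_gt0// ltr_wpDl ?sqrtr_ge0.
have [P0 lnP] : 0 < \prod_(i <= k < j.+1) (f i / f k) /\
    ln (\prod_(i <= k < j.+1) (f i / f k)) =
    \sum_(i <= k < j.+1) (ln (f i) - ln (f k)).
  have fk0 k : (i <= k < j.+1)%N -> 0 < f k.
    by move=> /andP[ik kj]; rewrite f_gt0// (leq_trans i1 ik) (leq_trans _ jd).
  have [k /fk0 ?|P0 ->] := ln_prod_nat R (fun k => f i / f k) i j.+1.
    by rewrite divr_gt0.
  by split=> //; apply: eq_big_nat => k /fk0 ?; rewrite ln_div.
have l10 : 0 < (j - i + 1)%:R :> R by rewrite ltr0n addn1.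
have t1' : 0 < 1 - t by rewrite subr_gt0.
rewrite -ler_ln ?posrE ?mulr_gt0 ?powR_gt0//.
rewrite !lnM ?posrE ?mulr_gt0 ?powR_gt0// !ln_powR lnP.
have lnt : ln t = 2 * (ln (f j) - ln (f i)).
  by rewrite lnXn ?divr_gt0// ln_div ?posrE// mulr_natl.
have := @sum_ln_ratio_le R d f hf i j i1 ij jd; rewrite -lnt.
have -> : (d - i + 1)%:R = (d - j + 1)%:R + (j - i)%:R :> R.
  by rewrite -natrD; congr _%:R; rewrite addnAC addnBA ?(ltnW ij)// subnK.
have n1 : 1 <= (d - j + 1)%:R :> R by rewrite ler1n addn1.
have := @entropy_bound R (d - j + 1)%:R (j - i)%:R t n1 l1.
rewrite t0 t1 => /(_ isT).
rewrite (natrD _ (d - j) 1) addrK (natrD _ (j - i) 1).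
(* Of the 6 l supplied by [psi], one l absorbs the [+ 1] of [entropy_bound] and 5 l absorb l ln
   B. *)
have := @ln_constant_le5 R; rewrite -/B => lnB.
have : (j - i)%:R * ln B <= (j - i)%:R * 5 by rewrite ler_pM2l//; lra.
lra.
Qed.
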